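(* For every integer $n\ge 1$, the king graph $\mathrm{King}_{4,n}$ is $3$-representable. Moreover, for every $n\ge 1$ there exists a word $Y_n$, in which each vertex of $\mathrm{King}_{4,n}$ appears exactly three times, that represents $\mathrm{King}_{4,n}$ and is such that: \begin{itemize} \item if $n$ is odd, then $Y_n$ contains the factors $x_{1,n}^{(2)}x_{3,n}^{(1)}x_{2,n}^{(2)}$ and $x_{3,n}^{(2)}x_{2,n}^{(3)}x_{4,n}^{(2)}$; \item if $n$ is even, then $Y_n$ contains the factors $x_{2,n}^{(1)}x_{1,n}^{(1)}x_{3,n}^{(1)}$ and $x_{2,n}^{(3)}x_{4,n}^{(2)}x_{3,n}^{(3)}$. \end{itemize}
   Context: All graphs are finite, simple and undirected. Two distinct letters $x,y$ alternate in a word $w$ if deleting from $w$ all letters other than $x$ and $y$ leaves a word of the form $xyxy\cdots$ or $yxyx\cdots$ (of even or odd length). A word $w$ over the alphabet $V$, in which every letter of $V$ occurs, represents a graph $G=(V,E)$ if for all distinct $x,y\in V$: $x$ and $y$ alternate in $w$ if and only if $(x,y)\in E$. $G$ is $k$-representable if it is represented by a word in which each letter appears exactly $k$ times. The king graph $\mathrm{King}_{m,n}$ has vertex set $\{x_{i,j}: 1\le i\le m,\ 1\le j\le n\}$, and two distinct vertices $x_{a,b}$, $x_{c,d}$ are adjacent if and only if $|a-c|\le 1$ and $|b-d|\le 1$. For a letter $x$ of a word $w$, $x^{(j)}$ denotes the $j$-th occurrence of $x$ in $w$ (counted from the left). A factor of a word is a contiguous subword; saying that $w$ contains the factor $x^{(i)}y^{(j)}z^{(k)}$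 means that the $i$-th occurrence of $x$, the $j$-th occurrence of $y$ and the $k$-th occurrence of $z$ in $w$ occupy three consecutive positions of $w$, in this order. *)

(* Defs.v *)
From mathcomp Require Import all_boot all_order all_algebra.

Set Implicit Arguments.
Unset Strict Implicit.
Unset Printing Implicit Defensive.

Section Words.
Variable T : finType.
Implicit Types (w : seq T) (x y z : T) (e : rel T).

(* The word x y x y ... of length n. *)
Definition alt_word x y (n : nat) : seq T :=
  mkseq (fun i => if odd i then y else x) n.

Definition alternate w x y : bool :=
  let u := [seq z <- w | z \in [:: x; y]] in
  (u == alt_word x y (size u)) || (u == alt_word y x (size u)).

(* A simple graph is given by its adjacency relation e, which is meant to be
   symmetric and irreflexive. *)
Definition represents w e : Prop :=
  (forall x, x \in w) /\
  (forall x y, x != y -> (alternate w x y <-> e x y)).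

Definition uniform (k : nat) w : Prop := forall x, count_mem x w = k.

Definition representable (k : nat) e : Prop :=
  exists w, uniform k w /\ represents w e.

(* The entry of w at the (0-based) position p is the i-th occurrence of x,
   where occurrences are counted from 1. *)
Definition occurs_at w (p : nat) x (i : nat) : bool :=
  (onth w p == Some x) && (count_mem x (take p.+1 w) == i).

Definition has_factor3 w x i y j z k : Prop :=
  exists p, [/\ occurs_at w p x i, occurs_at w p.+1 y j
              & occurs_at w p.+2 z k].

End Words.

(* The vertex x_{i,j} is the pair (i-1, j-1). *)
Definition king (m n : nat) : rel ('I_m * 'I_n) :=
  fun u v => [&& u != v, `|u.1 - v.1|%N <= 1 & `|u.2 - v.2|%N <= 1].

Lemma king_sym m n : symmetric (@king m n).
Proof.
move=> u v; rewrite /king eq_sym.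
by rewrite (distnC u.1 v.1) (distnC u.2 v.2).
Qed.

Lemma king_irrefl m n : irreflexive (@king m n).
Proof. by move=> u; rewrite /king eqxx. Qed.

(* The vertex x_{i,j} of the m.+1 by n.+1 king graph, with the 1-based indices
   1 <= i <= m.+1 and 1 <= j <= n.+1; meaningless outside these bounds. *)
Definition kingv (m n i j : nat) : 'I_m.+1 * 'I_n.+1 :=
  (inord i.-1, inord j.-1).

(* Main.v *)
(* Y_{n+1} is obtained by inserting column n+1 into Y_n.  Keep track of the
   last column only, a gap _ standing for an arbitrary word over the earlier
   columns:
     n odd:   _ 12 _ 132 _ 14 _ 324 _ 34 _
     n even:  _ 213 _ 21 _ 43 _ 243 _ 14 _
   The new letters (primed) are inserted as
     _ 12 _ 2'1'3' 132 2'1' _ 14 _ 4'3' 324 2'4'3' _ 34 1'4' _          (n odd)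
     _ 1'2' 213 1'3'2' _ 21 1'4' _ 43 _ 3'2'4' 243 3'4' _ 14 _          (n even)
   and, when the letters of column n are turned into gaps, each pattern yields
   the other one.  Every new letter occurs twice within some gap-free stretch,
   so it alternates with no letter of the columns before n; the pairs inside
   columns n and n+1 are a finite check. *)
Require Import Defs.
From mathcomp Require Import all_boot all_order all_algebra.
From mathcomp Require Import zify.

Set Implicit Arguments.
Unset Strict Implicit.
Unset Printing Implicit Defensive.

(** * Alternation and how it can fail *)

Section Alternation.
Variable T : finType.
Implicit Types (w s : seq T) (x y z : T).

Lemma alternateC w x y : alternate w x y = alternate w y x.
Proof.
rewrite /alternate orbC.
have -> // : [seq z <- w | z \in [:: y; x]] = [seq z <- w | z \in [:: x; y]].
by apply: eq_filter => z; rewrite !inE orbC.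
Qed.

Lemma alternate_filter (p : pred T) w x y :
  p x -> p y -> alternate [seq z <- w | p z] x y = alternate w x y.
Proof.
move=> px py; rewrite /alternate.
have -> // : [seq z <- [seq z <- w | p z] | z \in [:: x; y]]
             = [seq z <- w | z \in [:: x; y]].
rewrite -filter_predI; apply: eq_filter => z /=; rewrite !inE.
by case: eqP => [->|_]; case: eqP => [->|_]; rewrite ?px ?py.
Qed.

Lemma count_mem_filter (p : pred T) w x :
  p x -> count_mem x [seq z <- w | p z] = count_mem x w.
Proof.
by move=> px; rewrite count_filter; apply: eq_count => z /=; case: eqP => // ->.
Qed.

Lemma alternate_map (A : finType) (f : A -> T) (w : seq A) (x y : A) :
  injective f -> alternate (map f w) (f x) (f y) = alternate w x y.
Proof.
move=> f_inj; rewrite /alternate filter_map size_map.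
have -> : [seq z <- w | preim f (fun z => z \in [:: f x; f y]) z]
          = [seq z <- w | z \in [:: x; y]].
  by apply: eq_filter => z /=; rewrite !inE !(inj_eq f_inj).
set u := [seq z <- w | _].
have alt_map a b k : alt_word (f a) (f b) k = map f (alt_word a b k).
  by rewrite /alt_word /mkseq -map_comp; apply: eq_map => i /=; case: odd.
by rewrite !alt_map !(inj_eq (inj_map f_inj)).
Qed.

(** Positions of opposite parity in an alternating word carry different letters, so two neighbouring
    entries cannot both be [z]. *)
Lemma alt_word_square x y z k s1 s2 :
  x != y -> alt_word x y k != s1 ++ z :: z :: s2.
Proof.
move=> neq_xy; apply/eqP => e.
have k_eq : k = size s1 + (size s2).+2.
  rewrite -[LHS](size_mkseq (fun i => if odd i then y else x)).
  by rewrite -/(alt_word x y k) e size_cat.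
have nthE i : i < k -> nth z (s1 ++ z :: z :: s2) i = if odd i then y else x.
  by move=> lt_ik; rewrite -e nth_mkseq.
have := nthE (size s1); have := nthE (size s1).+1.
rewrite !nth_cat ltnn subnn [_ < size s1]ltnNge leqnSn subSnn /= k_eq.
move=> /(_ ltac:(lia)) e1 /(_ ltac:(lia)) e0; move: neq_xy.
by case: odd e1 e0 => /= <- <-; rewrite eqxx.
Qed.

(** Once all letters but [x] and [y] are deleted, [s] vanishes and the two displayed copies of [x]
    become neighbours. *)
Lemma alternate_square w1 s w2 x y :
  x != y -> x \notin s -> y \notin s ->
  alternate (w1 ++ x :: s ++ x :: w2) x y = false.
Proof.
move=> neq_xy xs ys; rewrite /alternate filter_cat /= filter_cat /=.
rewrite !inE eqxx /=.
have -> : [seq z <- s | z \in [:: x; y]] = [::].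
  apply/eqP; rewrite -(negbK (_ == _)) -has_filter.
  by apply/hasPn => z zs; rewrite !inE negb_or; apply/andP; split;
    apply: contraTneq zs => ->.
rewrite /=; set u := _ ++ _.
have neq_yx : y != x by rewrite eq_sym.
by rewrite !(eq_sym u) !(negbTE (alt_word_square _ _ _ _ _)).
Qed.

End Alternation.

(** * Words obtained by filling the gaps of a template *)

(* A template is a word over A with gaps [None], each of which stands for an
   arbitrary word over T; missing words count as empty. *)
Section Templates.
Variables (A T : finType) (f : A -> T).
Hypothesis f_inj : injective f.
Implicit Types (t : seq (option A)) (us : seq (seq T)).

Fixpoint fill t us : seq T :=
  match t with
  | [::] => [::]
  | Some a :: t' => f a :: fill t' us
  | None :: t' => head [::] us ++ fill t' (behead us)
  end.

Definition gap_count t := count_mem None t.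

Lemma fill_cat t1 t2 us :
  fill (t1 ++ t2) us = fill t1 us ++ fill t2 (drop (gap_count t1) us).
Proof.
elim: t1 us => [|[a|] t1 IH] us /=; first by rewrite drop0.
- by rewrite IH.
- by rewrite IH catA add1n; case: us => [|u us] /=; rewrite ?drop0.
Qed.

Lemma fill_letters s us : fill (map Some s) us = map f s.
Proof. by elim: s => //= a s ->. Qed.

Lemma filter_fill_gaps (p : pred T) t us :
  all (all p) us ->
  [seq z <- fill t us | p z] = fill [seq o <- t | oapp (p \o f) true o] us.
Proof.
elim: t us => [|[a|] t IH] us //= pus; first by rewrite IH //; case: ifP.
rewrite filter_cat IH; last by case: us pus => //= u us /andP[].
by case: us pus => //= u us /andP[/all_filterP-> _].
Qed.

Lemma filter_fill_letters (p : pred T) t us :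
  all (all (predC p)) us ->
  [seq z <- fill t us | p z] = map f [seq a <- pmap id t | p (f a)].
Proof.
elim: t us => [|[a|] t IH] us //= pus; first by rewrite IH //; case: ifP.
rewrite filter_cat IH; last by case: us pus => //= u us /andP[].
case: us pus => //= u us /andP[/all_filterP pu _].
by rewrite -pu -filter_predI (eq_filter (a2 := pred0)) ?filter_pred0 // => z /=;
  case: (p z).
Qed.

Lemma count_fill t us a :
  all (all (fun z => z != f a)) us ->
  count_mem (f a) (fill t us) = count_mem (Some a) t.
Proof.
elim: t us => [|[b|] t IH] us //= aus.
  by rewrite IH // (inj_eq f_inj).
rewrite count_cat IH; last by case: us aus => //= u us /andP[].
case: us aus => //= u us /andP[au _]; rewrite -[in RHS](add0n (_ + _)); congr addn.
by apply/eqP; rewrite -leqn0 leqNgt -has_count; apply: contraTN au;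
  rewrite -has_predC; apply: sub_has => z /= ->.
Qed.

(** The gap words contain no image of [f], so occurrence numbers can be read off the template; as
    the three letters differ, each number is one more than the count in [t1]. *)
Lemma fill_factor3 t1 t2 us a b c :
  all (all (fun z => z \notin codom f)) us ->
  uniq [:: a; b; c] ->
  has_factor3 (fill (t1 ++ [:: Some a, Some b, Some c & t2]) us)
    (f a) (count_mem (Some a) t1).+1
    (f b) (count_mem (Some b) t1).+1
    (f c) (count_mem (Some c) t1).+1.
Proof.
move=> fus; rewrite /= !inE negb_or andbT => /andP[/andP[ab ac] bc].
have countE d : count_mem (f d) (fill t1 us) = count_mem (Some d) t1.
  apply: count_fill; apply: sub_all fus => u; apply: sub_all => z.
  by apply: contraNneq => ->; exact: codom_f.
rewrite fill_cat /=; set w := fill t1 us; set w' := fill t2 _.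
have onthE s1 s2 (z : T) : onth (s1 ++ z :: s2) (size s1) = Some z.
  by elim: s1.
have takeE s1 s2 (z : T) : take (size s1).+1 (s1 ++ z :: s2) = s1 ++ [:: z].
  by elim: s1 => [|y s1 IH] /=; rewrite ?take0 ?IH.
exists (size w); split; apply/andP; split.
- by rewrite onthE.
- by rewrite takeE count_cat /= eqxx countE !addn0 addn1.
- by rewrite -cat_rcons -(size_rcons w (f a)) onthE.
- rewrite -cat_rcons -(size_rcons w (f a)) takeE cat_rcons count_cat /= countE.
  by rewrite !(inj_eq f_inj) eqxx (negbTE ab) add0n !addn0 addn1.
- by rewrite -cat_rcons -cat_rcons -(size_rcons w (f a)) -(size_rcons _ (f b)) onthE.
- rewrite -cat_rcons -cat_rcons -(size_rcons w (f a)) -(size_rcons _ (f b)) takeE.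
  rewrite !cat_rcons count_cat /= countE.
  by rewrite !(inj_eq f_inj) eqxx (negbTE ac) (negbTE bc) !add0n !addn0 addn1.
Qed.

(** Only gap words can supply [y], and there is no gap between the two displayed copies of [a]. *)
Lemma alternate_fill t1 s t2 us a y :
  a \notin s -> y \notin codom f ->
  alternate (fill (t1 ++ Some a :: map Some s ++ Some a :: t2) us) (f a) y
  = false.
Proof.
move=> a_s yf; rewrite fill_cat /= fill_cat fill_letters /=.
apply: alternate_square.
- by apply: contraNneq yf => <-; exact: codom_f.
- by rewrite mem_map.
- by apply: contra yf => /mapP[b _ ->]; exact: codom_f.
Qed.

End Templates.

Definition r1 := @Ordinal 4 0 isT.
Definition r2 := @Ordinal 4 1 isT.
Definition r3 := @Ordinal 4 2 isT.
Definition r4 := @Ordinal 4 3 isT.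

Lemma rowP (P : 'I_4 -> Prop) :
  P r1 -> P r2 -> P r3 -> P r4 -> forall i, P i.
Proof.
move=> P1 P2 P3 P4 [[|[|[|[|//]]]] lti].
- by rewrite (_ : Ordinal lti = r1) //; apply: val_inj.
- by rewrite (_ : Ordinal lti = r2) //; apply: val_inj.
- by rewrite (_ : Ordinal lti = r3) //; apply: val_inj.
- by rewrite (_ : Ordinal lti = r4) //; apply: val_inj.
Qed.

(* The new column becomes the last one; adjacent gaps are merged. *)
Fixpoint promote (t : seq (option (bool * 'I_4))) : seq (option 'I_4) :=
  match t with
  | [::] => [::]
  | Some (true, i) :: t' => Some i :: promote t'
  | _ :: t' => if promote t' is None :: r then None :: r else None :: promote t'
  end.

(** * Words over the first columns, and the insertion of one more column *)

Section Columns.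
Variable n : nat.
Local Notation V := ('I_4 * 'I_n.+1)%type.
Implicit Types (w : seq V) (m : nat).

Definition col m (i : 'I_4) : V := (i, inord m).

(** The boolean, read as 0 or 1, separates the old last column from the new one. Since [inord] has a
    default value, the new column is the intended one only for [m < n]. *)
Definition two_cols m (c : bool * 'I_4) : V := (c.2, inord (m + c.1)).

Lemma col_inj m : injective (col m).
Proof. by move=> i j []. Qed.

Lemma two_cols_col m (c : bool * 'I_4) : m < n -> (two_cols m c).2 = m + c.1 :> nat.
Proof. by move=> lt_mn; rewrite inordK //; case: c => [[] i] /=; lia. Qed.

Lemma two_cols_inj m : m < n -> injective (two_cols m).
Proof.
move=> lt_mn c d e; have := two_cols_col c lt_mn; have := two_cols_col d lt_mn.
rewrite -e => ->; case: c d e => [b i] [b' j] [-> _] /= /addnI.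
by case: b; case: b'.
Qed.

Lemma two_colsP m (x : V) :
  m < n -> m <= x.2 <= m.+1 -> x = two_cols m (m < x.2, x.1).
Proof.
case: x => i j /= lt_mn mj; rewrite /two_cols /=; congr pair; apply: val_inj.
by rewrite /= inordK; case: ltnP => /=; lia.
Qed.

Lemma king_two_cols m c d : m < n ->
  king (two_cols m c) (two_cols m d) = (c != d) && (`|c.2 - d.2|%N <= 1).
Proof.
move=> lt_mn; rewrite /king (inj_eq (two_cols_inj lt_mn)) !two_cols_col //.
have -> : `|(m + c.1)%N - (m + d.1)%N|%N <= 1.
  by case: c d => [[] i] [[] j] /=; lia.
by rewrite andbT.
Qed.

Lemma king_col m i j : king (col m i) (col m j) = (i != j) && (`|i - j|%N <= 1).
Proof.
by rewrite /king (inj_eq (@col_inj m)) /= distnn andbT.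
Qed.

(** The alphabet is that of the final graph at every stage, so the induction on [m] stays within one
    type; letters of later columns are required to be absent. *)
Definition represents_upto m w : Prop :=
  (forall x : V, count_mem x w = if x.2 <= m then 3 else 0) /\
  (forall x y : V, x != y -> x.2 <= m -> y.2 <= m -> alternate w x y = king x y).

Definition shape m (t : seq (option 'I_4)) w : Prop :=
  exists us, all (all (fun z : V => z.2 < m)) us /\ w = fill (col m) t us.

Lemma promote_shape m t us : m < n ->
  all (all (fun z : V => z.2 < m)) us ->
  shape m.+1 (promote t) (fill (two_cols m) t us).
Proof.
move=> lt_mn.
(* This mirrors the last branch of [promote]: [u] is absorbed by a leading gap of [r] if there is
   one, and otherwise fills a new gap. *)
have gap r u w : all (fun z : V => z.2 < m.+1) u -> shape m.+1 r w ->
    shape m.+1 (if r is None :: r' then None :: r' else None :: r) (u ++ w).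
  move=> um [vs [vsm ->]].
  case: r => [|[a|] r]; try by exists (u :: vs); rewrite /= um vsm.
  exists ((u ++ head [::] vs) :: behead vs); rewrite /= all_cat um catA.
  by case: vs vsm => //= v vs ->.
have widen u : all (fun z : V => z.2 < m) u -> all (fun z : V => z.2 < m.+1) u.
  by apply: sub_all => z; lia.
elim: t us => [|[[[] i]|] t IH] us usm /=; first by exists [::].
- have [vs [vsm ->]] := IH us usm; exists vs; split=> //=.
  by rewrite /col /two_cols /= addn1.
- rewrite -(cat1s (two_cols _ _)); apply: (gap _ _ _ _ (IH _ usm)).
  by rewrite /= inordK /= addn0 ?ltnSn // ltnS ltnW.
- case: us usm => [|u us] /= => [_|/andP[um usm]].
    exact: (gap _ [::] _ isT (IH [::] isT)).
  exact: (gap _ _ _ (widen _ um) (IH _ usm)).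
Qed.

(** A certificate independent of [m] and [n], hence checkable by computation. In [extends_old] the
    gaps must match as well, so that the same gap words fill both templates. *)
Record extends (t : seq (option 'I_4)) (t2 : seq (option (bool * 'I_4))) : Prop :=
  Extends {
    extends_old : [seq o <- t2 | oapp (fun c => ~~ c.1) true o]
                  = map (omap (pair false)) t;
    extends_count : forall c, count_mem c (pmap id t2) = 3;
    extends_alternate : forall c d, c != d ->
      alternate (pmap id t2) c d = (`|c.2 - d.2|%N <= 1);
    extends_square : forall i, exists t1 s t3, (true, i) \notin s /\
      t2 = t1 ++ Some (true, i) :: map Some s ++ Some (true, i) :: t3 }.

(** Two columns up to [m.+1] are both at most [m], or both at least [m], or are [m.+1] and one
    before [m]. In the first case the new word restricts to [w]; in the second it restricts to the
    letters of [t2], without gaps; in the third the vertices are not adjacent and [extends_square]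
    prevents alternation. *)
Lemma extend m t t2 w :
  m < n -> extends t t2 -> represents_upto m w -> shape m t w ->
  exists w', represents_upto m.+1 w' /\ shape m.+1 (promote t2) w'.
Proof.
move=> lt_mn [t2_old t2_count t2_alt t2_square] [w_count w_alt] [us [usm w_eq]].
exists (fill (two_cols m) t2 us); split; last exact: promote_shape.
have f_inj := two_cols_inj lt_mn.
set w' := fill _ t2 us.
have w'_old : [seq z : V <- w' | z.2 <= m] = w.
  rewrite filter_fill_gaps; last first.
    by apply: sub_all usm => u; apply: sub_all => z; exact: ltnW.
  rewrite w_eq (eq_filter (a2 := oapp (fun c => ~~ c.1) true)).
    rewrite t2_old; elim: (t) (us) => [|[a|] r IH] vs //=; rewrite IH //.
    by rewrite /two_cols /= addn0.
  by move=> [[b i]|] //=; rewrite inordK; case: b => /=; lia.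
have w'_new : [seq z : V <- w' | m <= z.2] = map (two_cols m) (pmap id t2).
  rewrite filter_fill_letters; last first.
    by apply: sub_all usm => u; apply: sub_all => z /=; rewrite -ltnNge.
  congr map; apply/all_filterP/allP => c _ /=; rewrite two_cols_col //; lia.
split=> [x|].
  have [le_xm|lt_mx] := leqP x.2 m.
    rewrite (_ : x.2 <= m.+1); last by lia.
    by rewrite -(count_mem_filter (p := fun z : V => z.2 <= m)) // w'_old w_count le_xm.
  rewrite -(count_mem_filter (p := fun z : V => m <= z.2)) ?(ltnW lt_mx) // w'_new.
  case: leqP => [le_xm|lt_m1x].
    rewrite (two_colsP lt_mn (x := x)) ?le_xm ?(ltnW lt_mx) //.
    rewrite count_map -[RHS](t2_count (m < x.2, x.1)); apply: eq_count => c /=.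
    by rewrite (inj_eq f_inj).
  (* A vertex beyond column [m.+1] is not a letter of the template. *)
  apply/count_memPn/mapP => -[c _ x_eq]; move: lt_m1x.
  by rewrite x_eq two_cols_col //; case: (c.1); lia.
have far (x y : V) : m < x.2 <= m.+1 -> y.2 < m -> alternate w' x y = king x y.
  move=> /andP[lt_mx le_xm] lt_ym.
  rewrite (two_colsP lt_mn (x := x)) ?le_xm ?(ltnW lt_mx) // lt_mx.
  have [t1 [s [t3 [xs t2_eq]]]] := t2_square x.1.
  rewrite /w' t2_eq alternate_fill //; last first.
    by apply/negP => /codomP[c y_eq]; move: lt_ym; rewrite y_eq two_cols_col //; lia.
  apply/esym/negbTE; rewrite /king two_cols_col //=; lia.
move=> x y neq_xy le_x le_y.
have [[le_xm le_ym]|[[le_mx le_my]|]] :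
    (x.2 <= m /\ y.2 <= m) \/ ((m <= x.2 /\ m <= y.2) \/
    ((m < x.2 /\ y.2 < m) \/ (m < y.2 /\ x.2 < m))) by lia.
- by rewrite -(w_alt x y) // -w'_old alternate_filter.
- rewrite -(alternate_filter (p := fun z : V => m <= z.2)) // w'_new.
  move: neq_xy; rewrite (two_colsP lt_mn (x := x)) ?le_mx //.
  rewrite (two_colsP lt_mn (x := y)) ?le_my // => neq_xy.
  rewrite alternate_map // king_two_cols //.
  by rewrite (inj_eq f_inj) in neq_xy; rewrite neq_xy t2_alt.
- by case=> -[lt1 lt2]; [|rewrite alternateC king_sym]; apply: far; rewrite ?lt1.
Qed.

End Columns.

(** * The two insertion templates and their finite verification *)

Definition old (i : 'I_4) := Some (false, i).
Definition new (i : 'I_4) := Some (true, i).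

Definition odd_step : seq (option (bool * 'I_4)) :=
  [:: None; old r1; old r2; None;
      new r2; new r1; new r3; old r1; old r3; old r2; new r2; new r1; None;
      old r1; old r4; None;
      new r4; new r3; old r3; old r2; old r4; new r2; new r4; new r3; None;
      old r3; old r4; new r1; new r4; None].

Definition even_step : seq (option (bool * 'I_4)) :=
  [:: None; new r1; new r2; old r2; old r1; old r3; new r1; new r3; new r2; None;
      old r2; old r1; new r1; new r4; None; old r4; old r3; None;
      new r3; new r2; new r4; old r2; old r4; old r3; new r3; new r4; None;
      old r1; old r4; None].

(** The parity in the name is that of the old column, counted from 1, so the old pattern comes from
    [even_step]. *)
Lemma odd_step_extends : extends (promote even_step) odd_step.
Proof.
split.
- by apply/eqP; vm_compute.
- by case=> [[]]; apply: rowP; vm_compute.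
- by case=> [[]]; apply: rowP; case=> [[]]; apply: rowP; vm_compute.
(* For each row, [take] stops just before one copy of the new letter and [drop] starts just after
   the next copy. *)
- apply: rowP.
  + by exists (take 5 odd_step),
      [:: (true, r3); (false, r1); (false, r3); (false, r2); (true, r2)],
      (drop 12 odd_step).
  + by exists (take 4 odd_step),
      [:: (true, r1); (true, r3); (false, r1); (false, r3); (false, r2)],
      (drop 11 odd_step).
  + by exists (take 17 odd_step),
      [:: (false, r3); (false, r2); (false, r4); (true, r2); (true, r4)],
      (drop 24 odd_step).
  + by exists (take 16 odd_step),
      [:: (true, r3); (false, r3); (false, r2); (false, r4); (true, r2)],
      (drop 23 odd_step).
Qed.

Lemma even_step_extends : extends (promote odd_step) even_step.
Proof.
split.
- by apply/eqP; vm_compute.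
- by case=> [[]]; apply: rowP; vm_compute.
- by case=> [[]]; apply: rowP; case=> [[]]; apply: rowP; vm_compute.
- apply: rowP.
  + by exists (take 1 even_step),
      [:: (true, r2); (false, r2); (false, r1); (false, r3)],
      (drop 7 even_step).
  + by exists (take 2 even_step),
      [:: (false, r2); (false, r1); (false, r3); (true, r1); (true, r3)],
      (drop 9 even_step).
  + by exists (take 18 even_step),
      [:: (true, r2); (true, r4); (false, r2); (false, r4); (false, r3)],
      (drop 25 even_step).
  + by exists (take 20 even_step),
      [:: (false, r2); (false, r4); (false, r3); (true, r3)],
      (drop 26 even_step).
Qed.

(* Columns are numbered from 0: m stands for the column m+1 of the paper. *)
Definition column_shape m :=
  promote (if odd m then odd_step else even_step).

(** * Induction on the columns, and the prescribed factors *)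

Lemma king4_word_upto n m : m <= n ->
  exists w : seq ('I_4 * 'I_n.+1),
    represents_upto m w /\ shape m (column_shape m) w.
Proof.
elim: m => [|m IH] lt_mn.
  (* With all gaps empty, the odd pattern spells 121321432434, which represents the path 1-2-3-4,
     that is, the single column. *)
  exists (fill (col n 0) (column_shape 0) [::]); split; last by exists [::].
  set s := pmap id (column_shape 0).
  have -> : fill (col n 0) (column_shape 0) [::] = map (col n 0) s by [].
  have col0 (x : 'I_4 * 'I_n.+1) : x.2 <= 0 -> x = col n 0 x.1.
    case: x => i j /=; rewrite leqn0 => /eqP j0; congr pair.
    by apply: val_inj; rewrite /= inordK.
  split=> [x|x y neq_xy /col0 x_eq /col0 y_eq].
    case: ifPn => [/col0 ->|x0].
      rewrite count_map (eq_count (a2 := pred1 x.1)); last first.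
        by move=> i /=; rewrite (inj_eq (@col_inj n 0)).
      by move: (x.1); apply: rowP; vm_compute.
    apply/count_memPn; apply: contra x0 => /mapP[i _ ->].
    by rewrite /= inordK.
  move: neq_xy; rewrite x_eq y_eq (inj_eq (@col_inj n 0)) => neq_ij.
  rewrite alternate_map; last exact: col_inj.
  rewrite king_col neq_ij /=.
  by move: (x.1) (y.1) neq_ij; do 2!apply: rowP; vm_compute.
have [w [w_rep w_shape]] := IH (ltnW lt_mn).
have step : extends (column_shape m) (if odd m then even_step else odd_step).
  rewrite /column_shape; case: odd; first exact: even_step_extends.
  exact: odd_step_extends.
by have := extend lt_mn step w_rep w_shape; rewrite /column_shape /=; case: odd.
Qed.

Lemma king4_word n : exists w : seq ('I_4 * 'I_n.+1),
  [/\ uniform 3 w, represents w (@king 4 n.+1) & shape n (column_shape n) w].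
Proof.
have [w [[w_count w_alt] w_shape]] := king4_word_upto (leqnn n).
have le_n (x : 'I_4 * 'I_n.+1) : x.2 <= n by rewrite -ltnS ltn_ord.
have w_unif : uniform 3 w by move=> x; rewrite w_count le_n.
exists w; split=> //; split=> [x|x y neq_xy]; last by rewrite w_alt ?le_n.
by rewrite -has_pred1 has_count w_unif.
Qed.

(** This turns a factor claim into a closed boolean test on the template, where [k] is the 0-based
    position, gaps included, at which the factor starts. *)
Lemma shape_factor3 k n m t (w : seq ('I_4 * 'I_n.+1)) a b c i1 i2 i3 :
  m <= n -> shape m t w ->
  [&& uniq [:: a; b; c],
      t == take k t ++ [:: Some a, Some b, Some c & drop k.+3 t] &
      [seq (count_mem (Some r) (take k t)).+1 | r <- [:: a; b; c]]
      == [:: i1; i2; i3]] ->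
  has_factor3 w (col n m a) i1 (col n m b) i2 (col n m c) i3.
Proof.
move=> le_mn [us [usm ->]] /and3P[abc_uniq].
set t1 := take k t => /eqP -> /eqP[<- <- <-].
apply: fill_factor3 => //; first exact: col_inj.
apply: sub_all usm => u; apply: sub_all => z lt_zm.
by apply/negP => /codomP[i z_eq]; move: lt_zm; rewrite z_eq /= inordK // ltnn.
Qed.

Theorem theorem4 :
  (forall n : nat, representable 3 (@king 4 n.+1)) /\
  (forall n : nat,
     let x := fun i : nat => kingv 3 n i n.+1 in
     exists Y : seq ('I_4 * 'I_n.+1),
       [/\ uniform 3 Y,
           represents Y (@king 4 n.+1),
           odd n.+1 ->
             has_factor3 Y (x 1) 2 (x 3) 1 (x 2) 2 /\
             has_factor3 Y (x 3) 2 (x 2) 3 (x 4) 2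
         & ~~ odd n.+1 ->
             has_factor3 Y (x 2) 1 (x 1) 1 (x 3) 1 /\
             has_factor3 Y (x 2) 3 (x 4) 2 (x 3) 3]).
Proof.
split=> n; have [w [w_unif w_rep w_shape]] := king4_word n; first by exists w.
have kingvE i (r : 'I_4) : r = i.-1 :> nat -> kingv 3 n i n.+1 = col n n r.
  by move=> r_eq; congr pair; apply: val_inj; rewrite /= inordK -r_eq.
rewrite /= (kingvE 1 r1) // (kingvE 2 r2) // (kingvE 3 r3) // (kingvE 4 r4) //.
(* The last column has index [n] from 0, so [odd n.+1] selects [promote even_step]. The factors 132
   and 324 start there at positions 4 and 11; in the other pattern, 213 and 243 start at 1 and
   11. *)
exists w; split=> //; rewrite ?negbK => n_par.
  move: w_shape; rewrite /column_shape (negbTE n_par) => w_shape.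
  by split; [apply: (shape_factor3 (k := 4) (leqnn n) w_shape)
            |apply: (shape_factor3 (k := 11) (leqnn n) w_shape)]; vm_compute.
move: w_shape; rewrite /column_shape n_par => w_shape.
by split; [apply: (shape_factor3 (k := 1) (leqnn n) w_shape)
          |apply: (shape_factor3 (k := 11) (leqnn n) w_shape)]; vm_compute.
Qed.
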